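(* Let $G$ be a group which is not locally nilpotent, and suppose that every maximal locally nilpotent subgroup of $G$ is malnormal in $G$. Then $G$ is a domain (i.e. an equational domain).
   Context: Conventions: $H^x=x^{-1}Hx$. A group is locally nilpotent if each of its finitely generated subgroups is nilpotent. A maximal locally nilpotent subgroup of $G$ is a maximal element, with respect to inclusion, of the set of locally nilpotent subgroups of $G$. A subgroup $H\leq G$ is malnormal if $H\cap H^x=1$ for every $x\in G\setminus H$. For $X=\{x_1,\ldots,x_n\}$, let $G[X]=G\ast\mathbb{F}[X]$ be the free product of $G$ with the free group $\mathbb{F}[X]$ on $X$; its elements are group words $w(x_1,\ldots,x_n)$ in the variables with coefficients from $G$. For $S\subseteq G[X]$, put $V_G(S)=\{(g_1,\ldots,g_n)\in G^n : w(g_1,\ldots,g_n)=1 \text{ for all } w\in S\}$. Subsets of $G^n$ of this form are called algebraic sets. The group $G$ is a domain (equational domain) if for every positive integer $n$, the union of any two algebraic sets in $G^n$ is again an algebraic set. *)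

(* Defs.v *)
From HB Require Import structures.
From mathcomp Require Import all_boot.
From mathcomp Require Import boolp classical_sets cardinality.

Set Implicit Arguments.
Unset Strict Implicit.
Unset Printing Implicit Defensive.

Import Algebra.
Local Open Scope classical_set_scope.
Local Open Scope group_scope.
Local Open Scope quotient_scope.

Section Subgroups.
Variable G : groupType.
Implicit Types (A B H K : set G) (x y : G).

Definition is_subgroup H : Prop :=
  [/\ H 1, forall x y, H x -> H y -> H (x * y) & forall x, H x -> H x^-1].

Definition subgroup_gen A : set G := smallest is_subgroup A.

Definition finitely_generated H : Prop :=
  exists2 A, finite_set A & H = subgroup_gen A.

Definition commutator_subgroup A B : set G :=
  subgroup_gen [set z | exists x y, [/\ A x, B y & z = [~ x, y]]].

(* Indexed from 0: [lower_central H 0 = H]. *)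
Definition lower_central H (c : nat) : set G :=
  iter c (fun K => commutator_subgroup K H) H.

Definition nilpotent_subgroup H : Prop :=
  exists c, lower_central H c = [set 1].

Definition locally_nilpotent H : Prop :=
  forall K, is_subgroup K -> K `<=` H -> finitely_generated K ->
    nilpotent_subgroup K.

Definition maximal_locally_nilpotent H : Prop :=
  [/\ is_subgroup H, locally_nilpotent H &
      forall K, is_subgroup K -> locally_nilpotent K -> H `<=` K -> K = H].

Definition conj_set H x : set G := [set h ^ x | h in H].

Definition malnormal H : Prop :=
  forall x, ~ H x -> H `&` conj_set H x = [set 1].

End Subgroups.

(* The free product of [G] with the free group on [X], presented as formal
   group terms over the constants from [G] and the variables from [X], modulo
   the least congruence satisfying the group axioms and identifying products of
   constants with constants.  The universal property is proved below
   ([gword_universal]). *)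
Section FreeProduct.
Variables (G : groupType) (X : Type).

Inductive gterm : Type :=
| GConst of G
| GVar of X
| GOne
| GMul of gterm & gterm
| GInv of gterm.

HB.instance Definition _ := gen_eqMixin gterm.
HB.instance Definition _ := gen_choiceMixin gterm.

Inductive gterm_cong : gterm -> gterm -> Prop :=
| gcong_refl t : gterm_cong t t
| gcong_sym t u : gterm_cong t u -> gterm_cong u t
| gcong_trans t u v : gterm_cong t u -> gterm_cong u v -> gterm_cong t v
| gcong_mul t t' u u' :
    gterm_cong t t' -> gterm_cong u u' -> gterm_cong (GMul t u) (GMul t' u')
| gcong_inv t t' : gterm_cong t t' -> gterm_cong (GInv t) (GInv t')
| gcong_mulA t u v : gterm_cong (GMul t (GMul u v)) (GMul (GMul t u) v)
| gcong_mul1 t : gterm_cong (GMul GOne t) t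
| gcong_mul1r t : gterm_cong (GMul t GOne) t
| gcong_mulV t : gterm_cong (GMul (GInv t) t) GOne
| gcong_mulVr t : gterm_cong (GMul t (GInv t)) GOne
| gcong_const g h : gterm_cong (GConst (g * h)) (GMul (GConst g) (GConst h)).

Definition gterm_eqv (t u : gterm) : bool := `[< gterm_cong t u >].

Fact gterm_eqv_refl : reflexive gterm_eqv.
Proof. by move=> t; apply/asboolP/gcong_refl. Qed.

Fact gterm_eqv_sym : symmetric gterm_eqv.
Proof. by move=> t u; apply/asboolP/asboolP => /gcong_sym. Qed.

Fact gterm_eqv_trans : transitive gterm_eqv.
Proof.
by move=> t u v /asboolP ut /asboolP tv; apply/asboolP/(gcong_trans ut tv).
Qed.

Canonical gterm_equiv :=
  EquivRel gterm_eqv gterm_eqv_refl gterm_eqv_sym gterm_eqv_trans.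

Definition gword : Type := {eq_quot gterm_eqv}.

HB.instance Definition _ := Choice.on gword.

Definition gclass (t : gterm) : gword := \pi_{eq_quot gterm_eqv} t.
Definition grepr (w : gword) : gterm := repr (w : {eq_quot gterm_eqv}).

Lemma greprK : cancel grepr gclass.
Proof. by move=> w; rewrite /gclass /grepr reprK. Qed.

Lemma gclassP t u : gclass t = gclass u <-> gterm_cong t u.
Proof.
split; first by move=> /eqmodP/asboolP.
by move=> tu; apply/eqmodP/asboolP.
Qed.

Lemma grepr_class t : gterm_cong (grepr (gclass t)) t.
Proof. by apply/gclassP; rewrite greprK. Qed.

Definition gword_mul (w w' : gword) : gword := gclass (GMul (grepr w) (grepr w')).
Definition gword_inv (w : gword) : gword := gclass (GInv (grepr w)).
Definition gword_one : gword := gclass GOne.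

Lemma gclassM t u : gclass (GMul t u) = gword_mul (gclass t) (gclass u).
Proof.
by apply/gclassP; apply: gcong_mul; apply: gcong_sym; apply: grepr_class.
Qed.

Lemma gclassV t : gclass (GInv t) = gword_inv (gclass t).
Proof.
by apply/gclassP; apply: gcong_inv; apply: gcong_sym; apply: grepr_class.
Qed.

Fact gword_mulA : associative gword_mul.
Proof.
move=> x y z; rewrite -(greprK x) -(greprK y) -(greprK z) -!gclassM.
exact/gclassP/gcong_mulA.
Qed.

Fact gword_mul1 : left_id gword_one gword_mul.
Proof. by move=> x; rewrite -(greprK x) -gclassM; apply/gclassP/gcong_mul1. Qed.

Fact gword_mul1r : right_id gword_one gword_mul.
Proof. by move=> x; rewrite -(greprK x) -gclassM; apply/gclassP/gcong_mul1r. Qed.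

Fact gword_mulV : left_inverse gword_one gword_inv gword_mul.
Proof.
by move=> x; rewrite -(greprK x) -gclassV -gclassM; apply/gclassP/gcong_mulV.
Qed.

Fact gword_mulVr : right_inverse gword_one gword_inv gword_mul.
Proof.
by move=> x; rewrite -(greprK x) -gclassV -gclassM; apply/gclassP/gcong_mulVr.
Qed.

HB.instance Definition _ := isGroup.Build gword
  gword_mulA gword_mul1 gword_mul1r gword_mulV gword_mulVr.

Definition gconst (g : G) : gword := gclass (GConst g).
Definition gvar (x : X) : gword := gclass (GVar x).

Lemma gconstM : {morph gconst : g h / g * h}.
Proof.
by move=> g h; apply: etrans (gclassM _ _); apply/gclassP/gcong_const.
Qed.

Section Lift.
Variables (H : groupType) (f : G -> H) (v : X -> H).

Fixpoint gterm_eval (t : gterm) : H :=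
  match t with
  | GConst g => f g
  | GVar x => v x
  | GOne => 1
  | GMul t u => gterm_eval t * gterm_eval u
  | GInv t => (gterm_eval t)^-1
  end.

Definition gword_lift (w : gword) : H := gterm_eval (grepr w).

Hypothesis fM : {morph f : g h / g * h}.

Lemma gterm_eval_cong t u : gterm_cong t u -> gterm_eval t = gterm_eval u.
Proof.
elim=> {t u} /=.
- by [].
- by move=> t u _ ->.
- by move=> t u w _ -> _ ->.
- by move=> t t' u u' _ -> _ ->.
- by move=> t t' _ ->.
- by move=> *; rewrite mulgA.
- by move=> *; rewrite mul1g.
- by move=> *; rewrite mulg1.
- by move=> *; rewrite mulVg.
- by move=> *; rewrite mulgV.
- by move=> *; rewrite fM.
Qed.

Lemma gword_lift_class t : gword_lift (gclass t) = gterm_eval t.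
Proof. exact/gterm_eval_cong/grepr_class. Qed.

Lemma gword_liftM : {morph gword_lift : w w' / w * w'}.
Proof. by move=> w w'; rewrite [LHS]gword_lift_class. Qed.

Lemma gword_lift_const g : gword_lift (gconst g) = f g.
Proof. exact: gword_lift_class. Qed.

Lemma gword_lift_var x : gword_lift (gvar x) = v x.
Proof. exact: gword_lift_class. Qed.

Lemma gword_lift_unique (h : gword -> H) :
  {morph h : w w' / w * w'} -> (forall g, h (gconst g) = f g) ->
  (forall x, h (gvar x) = v x) -> h =1 gword_lift.
Proof.
move=> hM hc hv w; rewrite -(greprK w) gword_lift_class.
have h1 : h 1 = 1 by apply: (mulgI (h 1)); rewrite -hM !mulg1.
elim: (grepr w) => [g|x||t IHt u IHu|t IHt] /=.
- exact: hc.
- exact: hv.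
- exact: h1.
- by rewrite gclassM [LHS]hM IHt IHu.
- by apply: (mulgI (gterm_eval t)); rewrite mulgV -IHt -hM gclassV [X in h X]mulgV.
Qed.

End Lift.

Theorem gword_universal (H : groupType) (f : G -> H) (v : X -> H) :
  {morph f : g h / g * h} ->
  exists! h : gword -> H,
    [/\ {morph h : w w' / w * w'}, forall g, h (gconst g) = f g &
        forall x, h (gvar x) = v x].
Proof.
move=> fM; exists (gword_lift f v); split.
  split; [exact: gword_liftM|exact: gword_lift_const|exact: gword_lift_var].
by move=> h [hM hc hv]; apply/esym/funext/gword_lift_unique.
Qed.

End FreeProduct.

Section AlgebraicSets.
Variables (G : groupType) (n : nat).

Definition gword_eval (w : gword G 'I_n) (p : 'I_n -> G) : G :=
  gword_lift idfun p w.

Definition zero_set (S : set (gword G 'I_n)) : set ('I_n -> G) :=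
  [set p | forall w, S w -> gword_eval w p = 1].

Definition algebraic (Y : set ('I_n -> G)) : Prop :=
  exists S, Y = zero_set S.

End AlgebraicSets.

Definition equational_domain (G : groupType) : Prop :=
  forall n : nat, (0 < n)%N -> forall Y Z : set ('I_n -> G),
    algebraic Y -> algebraic Z -> algebraic (Y `|` Z).

(* Main.v *)
(** If [x, y <> 1] and [x] commutes with every conjugate of [y], let [M] be a
    maximal locally nilpotent subgroup containing [x]. Malnormality puts the
    centralizer of [x], hence every conjugate of [y], inside [M]; as
    [1 <> y ^ g] lies in both [M] and [M ^ g], it then forces every [g] into
    [M], so [G = M] is locally nilpotent. Otherwise [G] has no such
    zero-divisors, and [V(S) `|` V(T)] is cut out by the equations
    [[~ w, u ^ g] = 1] for [w] in [S], [u] in [T] and [g] in [G]. *)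
Require Import Defs.
From mathcomp Require Import all_boot.
From mathcomp Require Import boolp classical_sets cardinality.

Import Algebra.
Local Open Scope classical_set_scope.
Local Open Scope group_scope.

Section LocallyNilpotent.
Context {G : groupType}.
Implicit Types (A H K M : set G) (x y g : G).

Lemma subgroup_gen_sub A H : is_subgroup H -> A `<=` H -> subgroup_gen A `<=` H.
Proof. by move=> sH AH; apply: smallest_sub. Qed.

Lemma sub_subgroup_gen A : A `<=` subgroup_gen A.
Proof. exact: sub_smallest. Qed.

Lemma is_subgroup1 : is_subgroup [set 1 : G].
Proof.
split=> // [x y /= -> ->|x /= ->]; first by rewrite mulg1.
by rewrite invg1.
Qed.

Lemma is_subgroup_gen A : is_subgroup (subgroup_gen A).
Proof.
split=> [|x y Ax Ay|x Ax] H [sH AH]; case: (sH) => H1 HM HV //.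
  by apply: HM; [apply: Ax | apply: Ay].
by apply: HV; apply: Ax.
Qed.

Lemma abelian_locally_nilpotent H :
  (forall x y, H x -> H y -> x * y = y * x) -> locally_nilpotent H.
Proof.
(* The lower central series is indexed from 0, so term 1 is the derived subgroup, generated here by
   trivial commutators. *)
move=> cH K sK KH _; exists 1%N; rewrite /lower_central /=.
apply/seteqP; split; last by move=> _ ->; case: (is_subgroup_gen
  [set z | exists x y, [/\ K x, K y & z = [~ x, y]]]).
apply: subgroup_gen_sub is_subgroup1 _ => _ [x [y [Kx Ky ->]]] /=.
by apply/eqP/commgP; apply: cH; apply: KH.
Qed.

(** The double centralizer of [x]: an abelian subgroup containing [x], used to start Zorn's lemma
    without handling powers of [x]. *)
Definition bicommutant x : set G :=
  [set z | forall c, c * x = x * c -> z * c = c * z].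

Lemma is_subgroup_bicommutant x : is_subgroup (bicommutant x).
Proof.
split=> [c _|y z By Bz c cx|y By c cx]; first by rewrite mulg1 mul1g.
  by rewrite -mulgA Bz // !mulgA By.
by apply: (mulgI y); rewrite mulVKg mulgA By // mulgK.
Qed.

(** Each [z] in the bicommutant commutes with [x], so every other element of the bicommutant
    commutes with [z]. *)
Lemma bicommutant_locally_nilpotent x : locally_nilpotent (bicommutant x).
Proof.
by apply: abelian_locally_nilpotent => y z By Bz; apply: By; apply: Bz.
Qed.

Lemma finite_sub_chain {T : Type} (F : set (set T)) (A : set T) :
  F !=set0 -> total_on F subset -> finite_set A ->
  A `<=` \bigcup_(X in F) X -> exists2 X, F X & A `<=` X.
Proof.
(* Classically [T] has a decidable equality, which lets the finite set [A] be listed as a sequence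
   for induction. *)
elim/Pchoice: T => T in F A *.
move=> [X0 FX0] totF /finite_seqP [s ->].
elim: s => [|a s IHs] sF; first by exists X0 => // y /=; rewrite inE.
have [X FX sX] : exists2 X, F X & [set` s] `<=` X.
  by apply: IHs => y /= ys; apply: sF; rewrite /= inE ys orbT.
have [Y FY Ya] : (\bigcup_(X in F) X) a by apply: sF; rewrite /= mem_head.
have [XY|YX] := totF _ _ FX FY.
  by exists Y => // y /=; rewrite inE => /predU1P [->//|/sX/XY].
by exists X => // y /=; rewrite inE => /predU1P [->|/sX//]; apply: YX.
Qed.

Lemma is_subgroup_bigcup_chain (F : set (set G)) :
  F !=set0 -> total_on F subset -> (forall H, F H -> is_subgroup H) ->
  is_subgroup (\bigcup_(H in F) H).
Proof.
move=> [H0 FH0] totF sF; split=> [|x y [H FH Hx] [K FK Ky]|x [H FH Hx]].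
- by exists H0 => //; case: (sF _ FH0).
- have [HK|KH] := totF _ _ FH FK.
    by exists K => //; case: (sF _ FK) => _ KM _; apply: KM => //; apply: HK.
  by exists H => //; case: (sF _ FH) => _ HM _; apply: HM => //; apply: KH.
- by exists H => //; case: (sF _ FH) => _ _; apply.
Qed.

(** The finitely many generators of [K] already lie in a single member of the chain, which then
    contains [K]. *)
Lemma locally_nilpotent_bigcup_chain (F : set (set G)) :
  F !=set0 -> total_on F subset ->
  (forall H, F H -> is_subgroup H /\ locally_nilpotent H) ->
  locally_nilpotent (\bigcup_(H in F) H).
Proof.
move=> F0 totF lnF K sK KF [A finA defK].
have [H FH AH] : exists2 H, F H & A `<=` H.
  apply: finite_sub_chain => // x Ax; apply: KF.
  by rewrite defK; apply: sub_subgroup_gen.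
have [sH lnH] := lnF _ FH; apply: lnH => //; last by exists A.
by rewrite defK; apply: subgroup_gen_sub.
Qed.

Lemma maximal_locally_nilpotent_containing x :
  exists2 M, maximal_locally_nilpotent M & M x.
Proof.
(* The empty set is admitted only so that the empty chain has a bound. *)
pose P H := H = set0 \/ [/\ is_subgroup H, locally_nilpotent H & H x].
have PB : P (bicommutant x).
  right; split; [exact: is_subgroup_bicommutant| |by move=> c ->].
  exact: bicommutant_locally_nilpotent.
have [F FP totF|M [PM maxM]] := @Zorn_bigcup G P.
  (* Discarding a possible empty member keeps the union and leaves only locally nilpotent subgroups
     containing [x]. *)
  pose F' := F `&` [set H | H x].
  have F'P H : F' H -> [/\ is_subgroup H, locally_nilpotent H & H x].
    by move=> [/FP [->|//]].
  have totF' : total_on F' subset.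
    by move=> H K [FH _] [FK _]; apply: totF.
  have -> : \bigcup_(H in F) H = \bigcup_(H in F') H.
    apply/seteqP; split=> y [H FH Hy]; last by exists H => //; case: FH.
    exists H => //; split=> //.
    by case: (FP _ FH) => [H0|[]//]; rewrite H0 in Hy.
  have [->|/set0P F'0] := eqVneq F' set0; first by left; rewrite bigcup_set0.
  right; split.
  - by apply: is_subgroup_bigcup_chain => // H /F'P [].
  - by apply: locally_nilpotent_bigcup_chain => // H /F'P [].
  - by have [H FH] := F'0; exists H => //; case: FH.
case: PM => [M0|[sM lnM Mx]].
  (* An empty [M] would lie strictly inside the bicommutant, which satisfies [P]. *)
  case: (maxM (bicommutant x)) => //; rewrite M0.
  by split=> // /(_ x); apply=> c ->.
(* A locally nilpotent subgroup [K] above [M] contains [x], so it satisfies [P] and cannot be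
   strictly larger. *)
exists M => //; split=> // K sK lnK MK; apply: contrapT => KM.
apply: (maxM K); last by right; split=> //; apply: MK.
by split=> // KsubM; apply: KM; apply/seteqP.
Qed.

(** Otherwise [x ^ g] would be a nontrivial element of the intersection of [M] with its conjugate by
    [g]. *)
Lemma malnormal_mem M x g : malnormal M -> x != 1 -> M x -> M (x ^ g) -> M g.
Proof.
move=> malM x1 Mx Mxg; apply: contrapT => /malM MMg.
have : (M `&` conj_set M g) (x ^ g) by split=> //; exists x.
rewrite MMg /= => xg1; case/eqP: x1.
by apply: (can_inj (conjgK g)); rewrite xg1 conj1g.
Qed.

Lemma malnormal_no_zero_divisors x y :
  ~ locally_nilpotent [set: G] ->
  (forall M, maximal_locally_nilpotent M -> malnormal M) ->
  (forall g, [~ x, y ^ g] = 1) -> x = 1 \/ y = 1.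
Proof.
move=> nlnG malG xy; have [->|x1] := eqVneq x 1; first by left.
have [->|y1] := eqVneq y 1; [by right | case: nlnG].
have [M maxM Mx] := maximal_locally_nilpotent_containing x.
have malM := malG _ maxM.
have My g : M (y ^ g).
  apply: (malnormal_mem M x) => //.
  (* The conjugating element is now [y ^ g]; it centralizes [x], so it sends [x] to an element of
     [M]. *)
  suff /eqP -> : x ^ (y ^ g) == x by [].
  by rewrite conjg_fix xy.
have -> : [set: G] = M; last by case: maxM.
apply/seteqP; split=> // g _; apply: (malnormal_mem M y) => //.
by rewrite -[y]conjg1.
Qed.

End LocallyNilpotent.

Section Evaluation.
Context {G : groupType} {n : nat}.
Implicit Types (w u : gword G 'I_n) (p : 'I_n -> G).

Lemma gword_evalM p : {morph (@gword_eval G n)^~ p : w u / w * u}.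
Proof. by move=> w u; apply: gword_liftM. Qed.

Lemma gword_eval1 p : gword_eval 1 p = 1.
Proof. by apply: (mulgI (gword_eval 1 p)); rewrite -gword_evalM !mulg1. Qed.

Lemma gword_evalV p : {morph (@gword_eval G n)^~ p : w / w^-1}.
Proof.
move=> w; apply: (mulgI (gword_eval w p)).
by rewrite -gword_evalM !mulgV gword_eval1.
Qed.

Lemma gword_eval_const p g : gword_eval (gconst _ g) p = g.
Proof. exact: gword_lift_const. Qed.

Lemma gword_eval_commJ p w u g :
  gword_eval [~ w, u ^ gconst _ g] p = [~ gword_eval w p, gword_eval u p ^ g].
Proof.
by rewrite /commg /conjg !(gword_evalM, gword_evalV) gword_eval_const.
Qed.

End Evaluation.

Lemma no_zero_divisors_equational_domain (G : groupType) :
  (forall x y : G, (forall g, [~ x, y ^ g] = 1) -> x = 1 \/ y = 1) ->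
  equational_domain G.
Proof.
move=> nzd n _ _ _ [S ->] [T ->].
exists [set z | exists w u g, [/\ S w, T u & z = [~ w, u ^ gconst _ g]]].
apply/seteqP; split=> p.
  case=> [Sp|Tp] _ [w [u [g [Sw Tu ->]]]]; rewrite gword_eval_commJ.
    by rewrite (Sp w) // comm1g.
  by rewrite (Tp u) // conj1g commg1.
(* A common zero [p] outside both sets gives [w] in [S] and [u] in [T] whose nontrivial values at
   [p] would be zero-divisors. *)
move=> STp; apply: contrapT => /not_orP [/existsNP [w /not_implyP [Sw w1]]].
move=> /existsNP [u /not_implyP [Tu u1]].
have [g|//|//] := nzd (gword_eval w p) (gword_eval u p).
by rewrite -gword_eval_commJ; apply: STp; exists w, u, g.
Qed.

Theorem theorem3 (G : groupType) :
  ~ locally_nilpotent (@setT G) ->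
  (forall H : set G, maximal_locally_nilpotent H -> malnormal H) ->
  equational_domain G.
Proof.
move=> nlnG malG; apply: no_zero_divisors_equational_domain => x y.
exact: malnormal_no_zero_divisors.
Qed.
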